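(* The following problem is PSPACE-hard: given a finite set $\Phi$ of simple sequents (sequents $A\Rightarrow B$ with $A,B$ formulas) of $\mathsf{DFNL^*}$ and a $\mathsf{DFNL^*}$-sequent $\Gamma\Rightarrow A$, decide whether $\Phi\vdash_{\mathsf{DFNL^*}}\Gamma\Rightarrow A$.
   Context: Formulas of $\mathsf{DFNL^*}$ over a set $\mathsf{Prop}$ of propositional letters: $A::=p\mid A\wedge B\mid A\vee B\mid A\cdot B\mid A\backslash B\mid A/B$. Formula trees: $\Gamma::=A\mid\Gamma\circ\Delta$; $\Gamma[\Delta]$ denotes a tree with a distinguished occurrence of subtree $\Delta$. Sequents are $\Gamma\Rightarrow A$ with $\Gamma$ a formula tree or empty. $\mathsf{DFNL^*}$ has axioms (Id) $A\Rightarrow A$ and (D) $A\wedge(B\vee C)\Rightarrow(A\wedge B)\vee(A\wedge C)$, and rules: from $\Delta\Rightarrow A$ and $\Gamma[B]\Rightarrow C$ infer $\Gamma[\Delta\circ(A\backslash B)]\Rightarrow C$; from $A\circ\Gamma\Rightarrow B$ infer $\Gamma\Rightarrow A\backslash B$; from $\Gamma[A]\Rightarrow C$ and $\Delta\Rightarrow B$ infer $\Gamma[(A/B)\circ\Delta]\Rightarrow C$; from $\Gamma\circ B\Rightarrow A$ infer $\Gamma\Rightarrow A/B$ (in these two right rules $\Gamma$ may be empty); from $\Gamma[A\circ B]\Rightarrow C$ infer $\Gamma[A\cdot B]\Rightarrow C$; from $\Gamma\Rightarrow A$, $\Delta\Rightarrow B$ infer $\Gamma\circ\Delta\Rightarrow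 A\cdot B$; (Cut) from $\Delta\Rightarrow A$ and $\Gamma[A]\Rightarrow B$ infer $\Gamma[\Delta]\Rightarrow B$; from $\Gamma[A_i]\Rightarrow B$ infer $\Gamma[A_1\wedge A_2]\Rightarrow B$; from $\Gamma\Rightarrow A$, $\Gamma\Rightarrow B$ infer $\Gamma\Rightarrow A\wedge B$; from $\Gamma[A_1]\Rightarrow B$, $\Gamma[A_2]\Rightarrow B$ infer $\Gamma[A_1\vee A_2]\Rightarrow B$; from $\Gamma\Rightarrow A_i$ infer $\Gamma\Rightarrow A_1\vee A_2$. $\Phi\vdash_{\mathsf{DFNL^*}}\Gamma\Rightarrow A$ means $\Gamma\Rightarrow A$ is derivable in $\mathsf{DFNL^*}$ using the sequents of $\Phi$ as additional axioms (not closed under substitution). *)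

(* Defs.v *)
From HB Require Import structures.
From mathcomp Require Import all_boot.

Set Implicit Arguments.
Unset Strict Implicit.
Unset Printing Implicit Defensive.

Inductive move := MoveLeft | Stay | MoveRight.

(* Tapes are infinite to the right only: a left move from cell 0 stays put. *)
Definition apply_move (m : move) (h : nat) : nat :=
  match m with MoveLeft => h.-1 | Stay => h | MoveRight => h.+1 end.

(* A deterministic machine with input alphabet A and output alphabet B.  It
   has ntapes.+1 read-write tapes; the input is on tape ord0, the output on
   tape ord_max (the same tape if ntapes = 0).  A cell holds None (the blank),
   an input letter, an output letter or an auxiliary letter. *)
Record tm (A B : finType) := TM {
  ntapes : nat;
  aux : finType;
  state : finType;
  start : state;
  halting : pred state;
  accepting : pred state;
  delta : state -> {ffun 'I_ntapes.+1 -> option (A + B + aux)} ->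
          state * {ffun 'I_ntapes.+1 -> option (A + B + aux) * move}
}.

Record config (A B : finType) (M : tm A B) := Config {
  cstate : state M;
  chead : 'I_(ntapes M).+1 -> nat;
  ctape : 'I_(ntapes M).+1 -> nat -> option (A + B + aux M)
}.

Definition init_config (A B : finType) (M : tm A B) (w : seq A) : config M :=
  @Config A B M (start M) (fun=> 0)
    (fun i j => if i == ord0 then nth None [seq Some (inl (inl a)) | a <- w] j
                else None).

Definition step (A B : finType) (M : tm A B) (c : config M) : config M :=
  if halting (cstate c) then c else
  let r := delta (cstate c) [ffun i => ctape c i (chead c i)] in
  @Config A B M r.1
    (fun i => apply_move (r.2 i).2 (chead c i))
    (fun i j => if j == chead c i then (r.2 i).1 else ctape c i j).

Definition run (A B : finType) (M : tm A B) (w : seq A) (t : nat) : config M :=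
  iter t (@step A B M) (init_config M w).

(* Since heads start on cell 0 and tapes are one-way, "every head stays below
   s" says that at most s cells of each tape are scanned. *)
Definition PSPACE (A : finType) (L : seq A -> Prop) : Prop :=
  exists (M : tm A void) (c d : nat), forall w : seq A,
    (forall t i, chead (run M w t) i < c * size w ^ d + c) /\
    (exists t, halting (cstate (run M w t)) /\
               (accepting (cstate (run M w t)) <-> L w)).

Definition polytime (A B : finType) (f : seq A -> seq B) : Prop :=
  exists (M : tm A B) (c d : nat), forall w : seq A,
    let e := run M w (c * size w ^ d + c) in
    halting (cstate e) /\
    (forall j, ctape e ord_max j =
               nth None [seq Some (inl (inr b)) | b <- f w] j).

(* P is a decision problem with instances in X, written over the alphabet B
   by means of [encode]. *)
Definition PSPACE_hard (X : Type) (B : finType) (encode : X -> seq B)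
    (P : X -> Prop) : Prop :=
  forall (A : finType) (L : seq A -> Prop), PSPACE L ->
    exists f : seq A -> X,
      polytime (fun w => encode (f w)) /\ (forall w, L w <-> P (f w)).

(* The propositional letters are a countably infinite set, indexed by nat. *)
Inductive formula :=
  | Letter of nat
  | And of formula & formula
  | Or of formula & formula
  | Prod of formula & formula
  | Under of formula & formula  (* Under A B is A \ B *)
  | Over of formula & formula.  (* Over A B is A / B *)

Lemma formula_eq_dec : comparable formula.
Proof. by move=> A B; rewrite /decidable; do ?decide equality. Qed.

HB.instance Definition _ := hasDecEq.Build formula (compareP formula_eq_dec).

Inductive tree := Leaf of formula | Node of tree & tree.

(* None is the empty antecedent. *)
Definition antecedent := option tree.

Coercion antecedent_of_formula (A : formula) : antecedent := Some (Leaf A).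

(* The empty antecedent is a unit for the structural operation. *)
Definition comp (G D : antecedent) : antecedent :=
  match G, D with
  | Some g, Some d => Some (Node g d)
  | None, _ => D
  | _, None => G
  end.

Inductive context :=
  | Hole
  | NodeL of context & tree
  | NodeR of tree & context.

(* Plugging the empty antecedent deletes the distinguished occurrence. *)
Fixpoint plug (G : context) (D : antecedent) : antecedent :=
  match G with
  | Hole => D
  | NodeL G' t => comp (plug G' D) (Some t)
  | NodeR t G' => comp (Some t) (plug G' D)
  end.

(* (A, B) stands for the sequent A => B. *)
Definition simple_sequent := (formula * formula)%type.

(* G and D range over all antecedents, including the empty one; for an empty G
   the premises of D_underR and D_overR read A => B and B => A. *)
Inductive derives (Phi : seq simple_sequent) : antecedent -> formula -> Prop :=
  | D_ax (A B : formula) : (A, B) \in Phi -> derives Phi A B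
  | D_id (A : formula) : derives Phi A A
  | D_distr (A B C : formula) :
      derives Phi (And A (Or B C)) (Or (And A B) (And A C))
  | D_underL (G : context) (D : antecedent) (A B C : formula) :
      derives Phi D A -> derives Phi (plug G B) C ->
      derives Phi (plug G (comp D (Under A B))) C
  | D_underR (G : antecedent) (A B : formula) :
      derives Phi (comp A G) B -> derives Phi G (Under A B)
  | D_overL (G : context) (D : antecedent) (A B C : formula) :
      derives Phi (plug G A) C -> derives Phi D B ->
      derives Phi (plug G (comp (Over A B) D)) C
  | D_overR (G : antecedent) (A B : formula) :
      derives Phi (comp G B) A -> derives Phi G (Over A B)
  | D_prodL (G : context) (A B C : formula) :
      derives Phi (plug G (comp A B)) C ->
      derives Phi (plug G (Prod A B)) C
  | D_prodR (G D : antecedent) (A B : formula) :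
      derives Phi G A -> derives Phi D B -> derives Phi (comp G D) (Prod A B)
  | D_cut (G : context) (D : antecedent) (A B : formula) :
      derives Phi D A -> derives Phi (plug G A) B -> derives Phi (plug G D) B
  | D_andL1 (G : context) (A1 A2 B : formula) :
      derives Phi (plug G A1) B -> derives Phi (plug G (And A1 A2)) B
  | D_andL2 (G : context) (A1 A2 B : formula) :
      derives Phi (plug G A2) B -> derives Phi (plug G (And A1 A2)) B
  | D_andR (G : antecedent) (A B : formula) :
      derives Phi G A -> derives Phi G B -> derives Phi G (And A B)
  | D_orL (G : context) (A1 A2 B : formula) :
      derives Phi (plug G A1) B -> derives Phi (plug G A2) B ->
      derives Phi (plug G (Or A1 A2)) B
  | D_orR1 (G : antecedent) (A1 A2 : formula) :
      derives Phi G A1 -> derives Phi G (Or A1 A2)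
  | D_orR2 (G : antecedent) (A1 A2 : formula) :
      derives Phi G A2 -> derives Phi G (Or A1 A2).

(* The finite set of assumptions is given by a list of its elements. *)
Record instance := Instance {
  assumptions : seq simple_sequent;
  goal_ant : antecedent;
  goal_suc : formula
}.

Definition consequence (x : instance) : Prop :=
  derives (assumptions x) (goal_ant x) (goal_suc x).

Inductive token :=
  | TLetter | TTick | TEnd | TAnd | TOr | TProd | TUnder | TOver
  | TNode | TEmpty | TAssume | TGoal.

Definition tokens : seq token :=
  [:: TLetter; TTick; TEnd; TAnd; TOr; TProd; TUnder; TOver;
      TNode; TEmpty; TAssume; TGoal].

Definition token_code (t : token) : nat :=
  match t with
  | TLetter => 0 | TTick => 1 | TEnd => 2 | TAnd => 3 | TOr => 4 | TProd => 5
  | TUnder => 6 | TOver => 7 | TNode => 8 | TEmpty => 9 | TAssume => 10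
  | TGoal => 11
  end.

Lemma token_codeK : cancel token_code (nth TLetter tokens).
Proof. by case. Qed.

HB.instance Definition _ := Countable.copy token (can_type token_codeK).

Lemma tokens_enum : Finite.axiom tokens.
Proof. by case. Qed.

HB.instance Definition _ := isFinite.Build token tokens_enum.

(* Prefix notation.  Letter indices are written in unary; as unary indices
   convert to binary ones in polynomial time, hardness for this encoding
   entails hardness for the one with binary indices. *)
Fixpoint encode_formula (A : formula) : seq token :=
  match A with
  | Letter n => TLetter :: nseq n TTick ++ [:: TEnd]
  | And B C => TAnd :: encode_formula B ++ encode_formula C
  | Or B C => TOr :: encode_formula B ++ encode_formula C
  | Prod B C => TProd :: encode_formula B ++ encode_formula C
  | Under B C => TUnder :: encode_formula B ++ encode_formula C
  | Over B C => TOver :: encode_formula B ++ encode_formula C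
  end.

Fixpoint encode_tree (t : tree) : seq token :=
  match t with
  | Leaf A => encode_formula A
  | Node t1 t2 => TNode :: encode_tree t1 ++ encode_tree t2
  end.

Definition encode_antecedent (G : antecedent) : seq token :=
  if G is Some t then encode_tree t else [:: TEmpty].

Definition encode_assumption (s : simple_sequent) : seq token :=
  TAssume :: encode_formula s.1 ++ encode_formula s.2.

Definition encode_instance (x : instance) : seq token :=
  flatten [seq encode_assumption s | s <- assumptions x] ++
  TGoal :: encode_antecedent (goal_ant x) ++ encode_formula (goal_suc x).

Lemma encode_formula_inj A B s1 s2 :
  encode_formula A ++ s1 = encode_formula B ++ s2 -> A = B /\ s1 = s2.
Proof.
elim: A B s1 s2 => [n|A1 I1 A2 I2|A1 I1 A2 I2|A1 I1 A2 I2|A1 I1 A2 I2|A1 I1 A2 I2]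
  [m|B1 B2|B1 B2|B1 B2|B1 B2|B1 B2] s1 s2 //=;
  last by [case; rewrite -!catA => /I1[-> /I2[-> ->]]].
all: try by [case; rewrite -!catA => /I1[-> /I2[-> ->]]].
case; rewrite -!catA.
elim: n m => [|n IHn] [|m] //= [].
  by move=> ->.
by case/IHn => -[->] ->.
Qed.

Lemma encode_tree_inj t u s1 s2 :
  encode_tree t ++ s1 = encode_tree u ++ s2 -> t = u /\ s1 = s2.
Proof.
elim: t u s1 s2 => [A|t1 I1 t2 I2] [B|u1 u2] s1 s2 /=.
- by case/encode_formula_inj => -> ->.
- by case: A.
- by case: B.
- by case; rewrite -!catA => /I1[-> /I2[-> ->]].
Qed.

Lemma encode_antecedent_inj G D s1 s2 :
  encode_antecedent G ++ s1 = encode_antecedent D ++ s2 -> G = D /\ s1 = s2.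
Proof.
case: G D => [t|] [u|] /=.
- by case/encode_tree_inj => -> ->.
- by case: t => [[]|].
- by case: u => [[]|].
- by case.
Qed.

Lemma encode_instance_inj : injective encode_instance.
Proof.
case=> [P G A] [Q D B]; rewrite /encode_instance /=.
elim: P Q => [|p P IH] [|q Q] //=.
  case=> /encode_antecedent_inj[-> eAB].
  by case: (@encode_formula_inj A B [::] [::]); rewrite ?cats0 // => ->.
case: p q => [p1 p2] [q1 q2]; case; rewrite -!catA /=.
by case/encode_formula_inj=> -> /encode_formula_inj[-> /IH[-> -> ->]].
Qed.

(* Main.v *)
From mathcomp Require Import all_boot zify.
Require Import Defs.

(* Fix a letter k and write [box A] for k \ A.  The run of a machine with
   polynomially bounded space is laid out as one sequence u_0, u_1, u_2, ... of
   cells over a finite alphabet, each configuration taking P = (n + 2)^D cells,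
   so that u_(M+P+1) is a function of u_(M+P), u_M, u_(M+1) and u_(M+2).  With a
   letter per cell, each instance of this local recurrence is a simple sequent
   between formulas [box^j u]; since [box] preserves conjunctions, the
   conjunction of all [box^N u_N] with N <= P entails [box^N u_N] for every N.
   The sequents [u => acc], for accepting cells u, and [box acc => acc] then
   give acc if the machine accepts.  Conversely, in the powerset of the monoid
   (nat, +) with k read as {1}, a cell letter as the set of positions of that
   cell and acc as the empty set, all assumptions hold, and the goal fails if
   the machine rejects.

   The only part of the instance that depends on the input is a repetition of
   [box] or of a cell, P times; a machine prints it by stepping D heads, each on
   its own copy of the input, through a reflected Gray code. *)

Set Implicit Arguments.
Unset Strict Implicit.
Unset Printing Implicit Defensive.

(** * Soundness over the powerset of the additive monoid of natural numbers *)

Section Semantics.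
Variable V : nat -> nat -> Prop.

Fixpoint holds (A : formula) (x : nat) : Prop :=
  match A with
  | Letter n => V n x
  | And B C => holds B x /\ holds C x
  | Or B C => holds B x \/ holds C x
  | Prod B C => exists y z, [/\ holds B y, holds C z & x = y + z]
  | Under B C => forall y, holds B y -> holds C (y + x)
  | Over B C => forall y, holds C y -> holds B (x + y)
  end.

Fixpoint tree_holds (t : tree) (x : nat) : Prop :=
  match t with
  | Leaf A => holds A x
  | Node t u => exists y z, [/\ tree_holds t y, tree_holds u z & x = y + z]
  end.

Definition ant_holds (G : antecedent) (x : nat) : Prop :=
  if G is Some t then tree_holds t x else x = 0.

Fixpoint ctx_holds (G : context) (x : nat) : Prop :=
  match G with
  | Hole => x = 0
  | NodeL G' t => exists y z, [/\ ctx_holds G' y, tree_holds t z & x = y + z]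
  | NodeR t G' => exists y z, [/\ tree_holds t y, ctx_holds G' z & x = y + z]
  end.

Lemma comp_holds G D x :
  ant_holds (comp G D) x <->
  exists y z, [/\ ant_holds G y, ant_holds D z & x = y + z].
Proof.
case: G D => [g|] [d|] //=.
- split=> [h|[y [z [h -> ->]]]]; last by rewrite addn0.
  by exists x, 0; rewrite addn0.
- split=> [h|[y [z [-> h ->]]]] //.
  by exists 0, x.
- by split=> [->|[y [z [-> -> ->]]]] //; exists 0, 0.
Qed.

Local Arguments comp : simpl never.

(** Addition is commutative, so the share of the hole splits off wherever the hole stands. *)
Lemma plug_holds G D x :
  ant_holds (plug G D) x <->
  exists y z, [/\ ctx_holds G y, ant_holds D z & x = y + z].
Proof.
elim: G x => [|G IH t|t G IH] x; rewrite [plug _ _]/= ?comp_holds.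
- by split=> [h|[y [z [-> h ->]]]] //; exists 0, x.
- split.
    move=> [y [z [/IH[a [b [ha hb ->]]] hz ->]]].
    exists (a + z), b; split=> //; last by rewrite addnAC.
    by exists a, z.
  move=> [_ [b [[a [z [ha hz ->]]] hb ->]]].
  exists (a + b), z; split=> //; last by rewrite addnAC.
  by apply/IH; exists a, b.
- split.
    move=> [y [z [hy /IH[a [b [ha hb ->]]] ->]]].
    exists (y + a), b; split=> //; last by rewrite addnA.
    by exists y, a.
  move=> [_ [b [[y [a [hy ha ->]]] hb ->]]].
  exists y, (a + b); split=> //; last by rewrite addnA.
  by apply/IH; exists a, b.
Qed.

(** This is the common shape of the rules that act inside an antecedent: the conclusion has a
    stronger [D] where the premise has [E]. *)
Lemma plug_mono G D E C :
  (forall x, ant_holds D x -> ant_holds E x) ->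
  (forall x, ant_holds (plug G E) x -> holds C x) ->
  forall x, ant_holds (plug G D) x -> holds C x.
Proof.
move=> DE EC x /plug_holds[y [z [hy /DE hz ->]]].
by apply: EC; apply/plug_holds; exists y, z.
Qed.

Lemma derives_sound (Phi : seq simple_sequent) G A :
  (forall s, s \in Phi -> forall x, holds s.1 x -> holds s.2 x) ->
  derives Phi G A -> forall x, ant_holds G x -> holds A x.
Proof.
move=> hPhi; elim=> {G A}.
- by move=> A B ABin; apply: (hPhi _ ABin).
- by [].
- by move=> A B C x [hA [hB|hC]]; [left|right].
- move=> G D A B C _ IHA _; apply: plug_mono => x /comp_holds[y [z [/IHA hy hz ->]]].
  exact: hz.
- move=> G A B _ IH x hx y hy; apply: IH.
  by apply/comp_holds; exists y, x.
- move=> G D A B C _ + _ IHB; apply: plug_mono => x /comp_holds[y [z [hy /IHB hz ->]]].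
  exact: hy.
- move=> G A B _ IH x hx y hy; apply: IH.
  by apply/comp_holds; exists x, y.
- by move=> G A B C _; apply: plug_mono.
- move=> G D A B _ IHA _ IHB x /comp_holds[y [z [/IHA hy /IHB hz ->]]].
  by exists y, z.
- by move=> G D A B _ IHA _; apply: plug_mono.
- by move=> G A1 A2 B _; apply: plug_mono => x [].
- by move=> G A1 A2 B _; apply: plug_mono => x [].
- by move=> G A B _ IHA _ IHB x hx; split; [apply: IHA|apply: IHB].
- move=> G A1 A2 B _ IH1 _ IH2 x /plug_holds[y [z [hy [hz|hz] ->]]].
    by apply: IH1; apply/plug_holds; exists y, z.
  by apply: IH2; apply/plug_holds; exists y, z.
- by move=> G A1 A2 _ IH x /IH; left.
- by move=> G A1 A2 _ IH x /IH; right.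
Qed.

End Semantics.

(** * The modality [k \ _] *)

Definition box : formula -> formula := Under (Letter 0).

Section Box.
Variable Phi : seq simple_sequent.
Local Notation "A |- B" := (derives Phi (antecedent_of_formula A) B) (at level 70).

Lemma derives_trans A B C : A |- B -> B |- C -> A |- C.
Proof. by move=> AB BC; apply: (D_cut (G := Hole) AB). Qed.

Lemma derives_and A B C : A |- B -> A |- C -> A |- And B C.
Proof. exact: D_andR. Qed.

Lemma derives_andl A B : And A B |- A.
Proof. by apply: (D_andL1 (G := Hole)); apply: D_id. Qed.

Lemma derives_andr A B : And A B |- B.
Proof. by apply: (D_andL2 (G := Hole)); apply: D_id. Qed.

Lemma box_mono A B : A |- B -> box A |- box B.
Proof.
move=> AB; apply: D_underR.
by apply: (D_underL (G := Hole) (D := Letter 0)) AB; apply: D_id.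
Qed.

Lemma box_elim A : derives Phi (Some (Node (Leaf (Letter 0)) (Leaf (box A)))) A.
Proof. by apply: (D_underL (G := Hole) (D := Letter 0)); apply: D_id. Qed.

Lemma box_and A B : And (box A) (box B) |- box (And A B).
Proof.
apply: D_underR; apply: D_andR.
  by apply: (D_andL1 (G := NodeR (Leaf (Letter 0)) Hole)); apply: box_elim.
by apply: (D_andL2 (G := NodeR (Leaf (Letter 0)) Hole)); apply: box_elim.
Qed.

Lemma iter_box_mono n A B : A |- B -> iter n box A |- iter n box B.
Proof. by move=> AB; elim: n => //= n /box_mono. Qed.

Lemma iter_box_and n A B C :
  C |- iter n box A -> C |- iter n box B -> C |- iter n box (And A B).
Proof.
move=> CA CB; apply: derives_trans (derives_and CA CB) _.
elim: n {CA CB} => [|n IH]; first exact: D_id.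
exact: derives_trans (box_and _ _) (box_mono IH).
Qed.

End Box.

Lemma holds_iter_box V (hV : forall x, V 0 x <-> x = 1) n A x :
  holds V (iter n box A) x <-> holds V A (x + n).
Proof.
elim: n x => [|n IH] x; first by rewrite addn0.
rewrite iterS addnS -addSn -IH /=; split=> [h|h y /hV -> //].
by rewrite -add1n; apply/h/hV.
Qed.

(** * Sequences over a finite alphabet given by a local recurrence *)

Section History.
Variables (T : finType) (F : T -> T -> T -> T -> T) (final : pred T).

Definition acc : formula := Letter 1.
(* [Letter 2] is interpreted as true; it closes the nested conjunction. *)
Definition top : formula := Letter 2.
Definition cell (x : T) : formula := Letter (enum_rank x).+3.

Definition window (q : T * T * T * T) : formula :=
  let: (x, a, b, c) := q in
  And (cell a) (And (box (cell b)) (box (box (cell c)))).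

(** Read at position [M]: the cells at [M + P], [M], [M.+1] and [M.+2] force the cell at
    [(M + P).+1]. Only the number of boxes depends on [P], not the number of rules. *)
Definition rule (P : nat) (q : T * T * T * T) : simple_sequent :=
  let: (x, a, b, c) := q in
  (And (iter P box (cell x)) (window q),
   iter P box (box (cell (F x a b c)))).

Definition closing_rules : seq simple_sequent :=
  (box acc, acc) :: [seq (cell x, acc) | x <- enum final].

Definition rules (P : nat) : seq simple_sequent :=
  map (rule P) (enum {: T * T * T * T}) ++ closing_rules.

Definition chain (s : seq T) : formula :=
  foldr (fun x G => And (cell x) (box G)) top s.

Definition history_instance (P : nat) (s : seq T) : instance :=
  Instance (rules P) (chain s) acc.

Variables (P : nat) (u : nat -> T).
Hypothesis P_gt1 : 1 < P.
Hypothesis uF : forall M,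
  u (M + P).+1 = F (u (M + P)) (u M) (u M.+1) (u M.+2).

Let u_val (n N : nat) : Prop :=
  match n with
  | 0 => N = 1
  | 1 => False
  | 2 => True
  | m.+3 => m = enum_rank (u N)
  end.

Lemma cell_holds x N : holds u_val (cell x) N <-> x = u N.
Proof.
split=> [/= /val_inj/enum_rank_inj //|->]; exact: erefl.
Qed.

Lemma rules_valid : (forall N, ~~ final (u N)) ->
  forall s, s \in rules P -> forall N, holds u_val s.1 N -> holds u_val s.2 N.
Proof.
move=> nfin s; rewrite mem_cat => /orP[/mapP[[[[x a] b] c] _ ->]|].
  move=> N [/= /(holds_iter_box (fun=> iff_refl _))/cell_holds -> [hM [hM1 hM2]]].
  apply/(holds_iter_box (fun=> iff_refl _)).
  apply/(holds_iter_box (fun=> iff_refl _) 1); apply/cell_holds.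
  rewrite addn1 uF; congr F.
  - exact/cell_holds.
  - by apply/cell_holds; rewrite -addn1; apply/(holds_iter_box (fun=> iff_refl _) 1).
  - by apply/cell_holds; rewrite -addn2; apply/(holds_iter_box (fun=> iff_refl _) 2).
(* [box acc] holds nowhere, as position 1 satisfies [Letter 0] and [acc] is empty. *)
rewrite inE => /orP[/eqP-> N /= /(_ 1 erefl) //|].
case/mapP=> x; rewrite mem_enum => xf -> N /cell_holds xE.
by move: xf (nfin N); rewrite -xE unfold_in => ->.
Qed.

Lemma chain_holds s N :
  (forall j, j < size s -> nth (u 0) s j = u (N + j)) -> holds u_val (chain s) N.
Proof.
elim: s N => //= x s IH N sE; split.
  by have /= := sE 0 isT; rewrite addn0 => ->; apply/cell_holds.
move=> _ ->; apply: IH => j js.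
have -> : 1 + N + j = N + j.+1 by lia.
exact: (sE j.+1).
Qed.

Let G := chain (mkseq u P.+1).

Lemma chain_derives_init N : N < P.+1 ->
  derives (rules P) G (iter N box (cell (u N))).
Proof.
rewrite /G => ltN.
have: N < size (mkseq u P.+1) by rewrite size_mkseq.
rewrite -(nth_mkseq (u 0) u ltN); elim: N (mkseq _ _) {ltN} => [|N IH] [|x s] //=.
  by move=> _; apply: derives_andl.
by move=> /IH/box_mono; apply: derives_trans; apply: derives_andr.
Qed.

(** Strong induction: beyond the initial segment listed in [G], the recurrence rule is applied under
    [M] boxes. *)
Lemma chain_derives N : derives (rules P) G (iter N box (cell (u N))).
Proof.
elim/ltn_ind: N => N IH; have [|leN] := ltnP N P.+1; first exact: chain_derives_init.
have [M NE] : exists M, N = (M + P).+1 by exists (N - P.+1); lia.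
rewrite {}NE in leN IH *; rewrite uF.
pose q := (u (M + P), u M, u M.+1, u M.+2).
apply: (@derives_trans _ _ (iter M box (rule P q).1)).
  rewrite /=; do 3?[apply: iter_box_and].
  - by rewrite -iterD; apply: IH.
  - by apply: IH; lia.
  - by rewrite -[box _]/(iter 1 box _) -iterD addn1; apply: IH; lia.
  (* Here [M.+2 < (M + P).+1] uses [1 < P]. *)
  - by rewrite -[box _]/(iter 2 box _) -iterD addn2; apply: IH; lia.
rewrite -addn1 !iterD; apply/iter_box_mono/(D_ax (B := (rule P q).2)).
by rewrite mem_cat -surjective_pairing map_f ?mem_enum.
Qed.

Lemma history_complete N : final (u N) ->
  consequence (history_instance P (mkseq u P.+1)).
Proof.
move=> fN; apply: (derives_trans (chain_derives N)).
apply: (@derives_trans _ _ (iter N box acc)).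
  apply/iter_box_mono/D_ax; rewrite mem_cat inE; apply/orP; right.
  by rewrite map_f ?orbT // mem_enum.
(* The boxes in front of [acc] are removed one at a time by the assumption [box acc => acc]. *)
elim: N {fN} => [|N IH]; first exact: D_id.
apply: derives_trans (box_mono IH) (D_ax _).
by rewrite mem_cat inE eqxx orbT.
Qed.

Lemma history_sound : (forall N, ~~ final (u N)) ->
  ~ consequence (history_instance P (mkseq u P.+1)).
Proof.
move=> nfin der; apply: (derives_sound (rules_valid nfin) der (x := 0)).
apply: (@chain_holds _ 0) => j; rewrite size_mkseq add0n; exact: nth_mkseq.
Qed.

End History.

(** * The space-bounded run of a machine as a sequence of cells *)

Section Space.
Variables (A : finType) (M : tm A void).

Notation tape_index := 'I_(ntapes M).+1.
Notation symbol := (option (A + void + aux M)).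
Notation reads := {ffun tape_index -> symbol}.

(* State and scanned symbols before the step that led to the configuration
   described; None stands for the initial configuration. *)
Definition origin : Type := option (state M * reads).

(* [visited] holds the scanned symbols of those tapes whose head is at or to
   the left of the cell. *)
Definition tape_cell : Type :=
  bool * {ffun tape_index -> symbol} * {ffun tape_index -> bool} * origin * reads.

Definition sentinel (x : tape_cell) : bool := x.1.1.1.1.
Definition symbols (x : tape_cell) := x.1.1.1.2.
Definition heads (x : tape_cell) := x.1.1.2.
Definition source (x : tape_cell) : origin := x.1.2.
Definition visited (x : tape_cell) : reads := x.2.

(* [inl None] is the sentinel and [inl (Some y)] a cell of the input tape
   before the run starts. *)
Definition hcell : finType := (option (option A) + tape_cell)%type.

Definition next_state (p : origin) : state M :=
  if p is Some (q, r) then if halting q then q else (delta q r).1 else start M.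

Definition written (p : origin) (i : tape_index) : symbol :=
  if p is Some (q, r) then if halting q then r i else ((delta q r).2 i).1
  else None.

Definition shift (p : origin) (i : tape_index) : move :=
  if p is Some (q, r) then if halting q then Stay else ((delta q r).2 i).2
  else Stay.

Definition is_sentinel (x : hcell) : bool :=
  match x with inl y => y == None | inr B => sentinel B end.

Definition is_inr_with (f : tape_cell -> bool) (x : hcell) : bool :=
  if x is inr B then f B else false.

(** Here [x] precedes the new cell and [b] lies one row above it. Within a row the origin is copied
    from the left. At the start of a row [x] is the last cell of the row above, whose [visited] has
    collected the symbols under all heads. *)
Definition next_origin (x b : hcell) : origin :=
  if is_sentinel b then
    match b, x with
    | inr _, inr X => Some (next_state (source X), visited X)
    | _, _ => None
    end
  else if x is inr X then source X else None.

Definition next_symbol (p : origin) (b : hcell) (i : tape_index) : symbol :=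
  match b with
  | inl None => None
  | inl (Some y) => if i == ord0 then omap (fun a => inl (inl a)) y else None
  | inr B => if heads B i then written p i else symbols B i
  end.

(** The cell [b] lies above the new one, between [a] and [c]. Heads start just after the sentinel,
    and a left move from there stays put. *)
Definition next_head (p : origin) (a b c : hcell) (i : tape_index) : bool :=
  ~~ is_sentinel b &&
  match b with
  | inl _ => a == inl None
  | inr B =>
    match shift p i with
    | MoveLeft => is_inr_with (fun C => heads C i) c || heads B i && is_sentinel a
    | Stay => heads B i
    | MoveRight => is_inr_with (fun C => heads C i) a
    end
  end.

Definition next_cell (x a b c : hcell) : hcell :=
  let p := next_origin x b in
  let sym := [ffun i => next_symbol p b i] in
  let hd := [ffun i => next_head p a b c i] in
  inr (is_sentinel b, sym, hd, p,
       [ffun i => if hd i then sym i else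
                  if is_sentinel b then None else
                  if x is inr X then visited X i else None]).

Definition accepting_cell (x : hcell) : bool :=
  if x is inr X then
    halting (next_state (source X)) && accepting (next_state (source X))
  else false.

Variable w : seq A.
Let c := run M w.

Definition scanned (s : nat) : reads := [ffun i => ctape (c s) i (chead (c s) i)].

Definition origin_at (s : nat) : origin :=
  if s is s'.+1 then Some (cstate (c s'), scanned s') else None.

(* Cell [v.+1] describes position [v] of the tapes. *)
Definition cell_at (s v : nat) : tape_cell :=
  (v == 0,
   [ffun i => if v is j.+1 then ctape (c s) i j else None],
   [ffun i => v == (chead (c s) i).+1],
   origin_at s,
   [ffun i => if chead (c s) i < v then scanned s i else None]).

Definition raw_cell (v : nat) : option (option A) :=
  if v is j.+1 then Some (nth None (map Some w) j) else None.

(** Row 0 is the raw input and row [s.+1] is configuration [s]. Index 0 is padding, the left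
    neighbour of the first sentinel. *)
Definition history (P N : nat) : hcell :=
  if N is N'.+1 then
    if N' %/ P is s.+1 then inr (cell_at s (N' %% P))
    else inl (raw_cell (N' %% P))
  else inl (Some None).

Lemma cstateS s : cstate (c s.+1) = next_state (origin_at s.+1).
Proof. by rewrite /c /run iterS /step /=; case: ifP. Qed.

Lemma next_state_origin s : next_state (origin_at s) = cstate (c s).
Proof. by case: s => [|s] //; rewrite -cstateS. Qed.

Lemma cheadS s i :
  chead (c s.+1) i = apply_move (shift (origin_at s.+1) i) (chead (c s) i).
Proof. by rewrite /c /run iterS /step /=; case: ifP. Qed.

Lemma ctapeS s i j :
  ctape (c s.+1) i j =
  if j == chead (c s) i then written (origin_at s.+1) i else ctape (c s) i j.
Proof.
rewrite /c /run iterS /step /= -/(run M w s).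
by case: ifP => _ //=; rewrite ffunE; case: eqP => [->|].
Qed.

Variable P : nat.
Hypothesis P_gt0 : 0 < P.
Hypothesis head_lt : forall s i, (chead (c s) i).+1 < P.

Lemma history_raw v : v < P -> history P v.+1 = inl (raw_cell v).
Proof. by move=> ltvP; rewrite /history divn_small // modn_small. Qed.

Lemma history_cell s v : v < P -> history P (s.+1 * P + v).+1 = inr (cell_at s v).
Proof.
by move=> ltvP; rewrite /history divnMDl // divn_small // addn0 modnMDl modn_small.
Qed.

Lemma history_sentinel t v : v < P ->
  is_sentinel (history P (t * P + v).+1) = (v == 0).
Proof.
move=> ltvP; case: t => [|s]; first by rewrite mul0n add0n history_raw //; case: v ltvP.
by rewrite history_cell.
Qed.

Lemma next_originE t v (x b : hcell) : v < P ->
  x = history P (t.+1 * P + v) -> b = history P (t * P + v).+1 ->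
  next_origin x b = origin_at t.
Proof.
move=> ltvP -> ->; case: v ltvP => [|j] ltjP; last first.
  by rewrite /next_origin history_sentinel /= ?addnS ?history_cell // ltnW.
case: t => [|s]; first by rewrite mul0n add0n history_raw.
(* The predecessor of a row start is in column [P.-1] of the row above. Every head lies strictly to
   its left, so [visited] is complete there. *)
have -> : s.+2 * P + 0 = (s.+1 * P + P.-1).+1 by rewrite mulSn; lia.
rewrite !history_cell ?ltn_predL // /next_origin /= next_state_origin.
congr (Some (_, _)); apply/ffunP => i; rewrite ffunE ltn_predRL head_lt.
by [].
Qed.

Lemma next_symbolE t v i : v < P ->
  next_symbol (origin_at t) (history P (t * P + v).+1) i =
  if v is j.+1 then ctape (c t) i j else None.
Proof.
case: t => [|s] ltvP; rewrite ?mul0n ?add0n ?history_cell ?history_raw //.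
  case: v ltvP => [|j] //= _; case: eqP => // _.
  by elim: w j => [|a w' IH] [|j] //=.
rewrite [LHS]/= !ffunE; case: v ltvP => [|j] _; first by [].
by rewrite eqSS ctapeS /= ffunE.
Qed.

Lemma next_headE t v i : v < P ->
  next_head (origin_at t) (history P (t * P + v)) (history P (t * P + v).+1)
    (history P (t * P + v).+2) i = (v == (chead (c t) i).+1).
Proof.
case: v => [|j] ltjP.
  by rewrite /next_head history_sentinel.
case: t => [|s].
  by rewrite /next_head mul0n add0n !history_raw ?(ltnW ltjP) //; case: j ltjP.
(* The right neighbour may wrap around to the sentinel of the next row, which carries no head; nor
   is any head in column [P]. *)
have CE : is_inr_with (fun C => heads C i) (history P (s.+1 * P + j.+1).+2) =
          (j.+2 == (chead (c s) i).+1).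
  have [ltj2|leP] := ltnP j.+2 P.
    by rewrite -addnS history_cell //= ffunE.
  have -> : (s.+1 * P + j.+1).+2 = (s.+2 * P + 0).+1 by rewrite mulSn; lia.
  by rewrite history_cell //= ffunE; have := head_lt s i; lia.
rewrite /next_head CE (history_cell _ ltjP) addnS (history_cell _ (ltnW ltjP)) cheadS.
rewrite /is_inr_with [is_sentinel _]/= [is_sentinel (inr (cell_at s j))]/= /heads /= !ffunE.
rewrite /sentinel /=.
by case: (if _ then Stay else _) => /=; lia.
Qed.

Lemma history_next N :
  history P (N + P).+1 =
  next_cell (history P (N + P)) (history P N) (history P N.+1) (history P N.+2).
Proof.
have ltvP : N %% P < P by rewrite ltn_mod.
rewrite {1 2 3 4 5}(divn_eq N P); move: (N %/ P) (N %% P) ltvP => t v ltvP.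
rewrite addnAC -mulSnr history_cell // /next_cell.
rewrite (next_originE ltvP erefl erefl).
rewrite history_sentinel //; congr (inr (_, _, _, _, _)); apply/ffunP => i; rewrite !ffunE.
- by rewrite next_symbolE.
- by rewrite next_headE.
rewrite next_headE // next_symbolE //; case: eqP => [->|ne]; first by rewrite ltnSn.
case: v ltvP ne => [|j] //= ltjP ne.
rewrite addnS history_cell ?(ltnW ltjP) //= !ffunE ltnS leq_eqVlt.
by case: eqP => // e; case: ne; rewrite e.
Qed.

Lemma history_accepts s : halting (cstate (c s)) -> accepting (cstate (c s)) ->
  accepting_cell (history P (s.+1 * P).+1).
Proof.
move=> hs acs; rewrite -[_ * P]addn0 history_cell //=.
by rewrite next_state_origin hs.
Qed.

Lemma history_rejects :
  (forall s, halting (cstate (c s)) -> ~~ accepting (cstate (c s))) ->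
  forall N, ~~ accepting_cell (history P N).
Proof.
move=> rej [|N] //=; case: (N %/ P) => [|s] //=.
by rewrite next_state_origin; case: (boolP (halting _)) => //= /rej.
Qed.

End Space.

(** * Reflected Gray code in base m *)

Definition digit (m v i : nat) : nat := v %/ m ^ i %% m.

(** The quotient counts the completed sweeps of digit [i]; every second sweep runs downwards. *)
Definition gray_dir (m v i : nat) : bool := odd (v %/ m ^ i.+1).

Definition gray_pos (m v i : nat) : nat :=
  if gray_dir m v i then m.-1 - digit m v i else digit m v i.

Definition gray_stuck (m v i : nat) : bool :=
  gray_pos m v i == if gray_dir m v i then 0 else m.-1.

Section Gray.
Variable m : nat.
Hypothesis m_gt0 : 0 < m.

Lemma digit_lt v i : digit m v i < m. Proof. by rewrite ltn_mod. Qed.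

Lemma gray_stuckE v i : gray_stuck m v i = (digit m v i == m.-1).
Proof.
rewrite /gray_stuck /gray_pos; have := digit_lt v i.
by case: gray_dir => //; lia.
Qed.

Lemma gray_pos_lt v i : gray_pos m v i < m.
Proof. by rewrite /gray_pos; have := digit_lt v i; case: gray_dir => //; lia. Qed.

Lemma dvdn_expS v i :
  (m ^ i.+1 %| v.+1) = (m ^ i %| v.+1) && (digit m v i == m.-1).
Proof.
have mi_gt0 : 0 < m ^ i by rewrite expn_gt0 m_gt0.
have [/dvdnP[q vE]|ndvd] := boolP (m ^ i %| v.+1) => /=; last first.
  by apply: contraNF ndvd; apply: dvdn_trans; rewrite expnS dvdn_mull.
have q_gt0 : 0 < q by case: q vE.
have -> : digit m v i = q.-1 %% m.
  rewrite /digit; congr (_ %% m).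
  have -> : v = q.-1 * m ^ i + (m ^ i).-1 by nia.
  by rewrite divnMDl // divn_small ?addn0 // ltn_predL.
rewrite vE expnS dvdn_pmul2r // -{1}(prednK q_gt0).
rewrite /dvdn -addn1 -modnDml addn1.
have := ltn_pmod q.-1 m_gt0; rewrite leq_eqVlt => /orP[/eqP e|lt].
  by rewrite e modnn eqxx; apply/esym/eqP; lia.
by rewrite modn_small //; lia.
Qed.

(** A carry reaches digit [i] when all lower digits are maximal, that is, at the ends of their
    sweeps. A machine can thus detect it from its head positions and directions. *)
Lemma dvdn_stuck v i :
  (m ^ i %| v.+1) <-> (forall j, j < i -> gray_stuck m v j).
Proof.
elim: i => [|i IH]; first by rewrite expn0 dvd1n.
rewrite dvdn_expS; split=> [/andP[/IH h hi] j|h].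
  by rewrite ltnS leq_eqVlt => /orP[/eqP ->|/h //]; rewrite gray_stuckE.
by rewrite -gray_stuckE h // andbT; apply/IH => j ji; apply: h; apply: ltnW.
Qed.

Lemma divn_expS v i : v.+1 %/ m ^ i = (m ^ i %| v.+1) + v %/ m ^ i.
Proof. by rewrite divnS // expn_gt0 m_gt0. Qed.

Lemma gray_dirS v i :
  gray_dir m v.+1 i = gray_dir m v i (+) (m ^ i %| v.+1) && gray_stuck m v i.
Proof. by rewrite /gray_dir divn_expS oddD dvdn_expS gray_stuckE oddb addbC. Qed.

(** When a digit wraps from [m.-1] to 0, its direction flips and its position stays, so no head ever
    jumps. *)
Lemma gray_posS v i :
  gray_pos m v.+1 i =
  if (m ^ i %| v.+1) && ~~ gray_stuck m v i then
    if gray_dir m v i then (gray_pos m v i).-1 else (gray_pos m v i).+1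
  else gray_pos m v i.
Proof.
have lt := digit_lt v i.
rewrite /gray_pos gray_dirS gray_stuckE.
have -> : digit m v.+1 i = if m ^ i %| v.+1 then
    if digit m v i == m.-1 then 0 else (digit m v i).+1 else digit m v i.
  rewrite {1}/digit divn_expS; case: (m ^ i %| v.+1); last by rewrite add0n.
  rewrite -modnDmr -/(digit m v i) add1n; case: eqP => [->|ne].
    by rewrite prednK // modnn.
  by rewrite modn_small //; lia.
by case: (m ^ i %| v.+1); case: eqP => //=; case: gray_dir => /=; lia.
Qed.

Lemma gray_pos_small v i : v < m ^ i.+1 -> gray_pos m v i = v %/ m ^ i.
Proof.
move=> lt; rewrite /gray_pos /gray_dir divn_small //= /digit modn_small //.
by rewrite ltn_divLR ?expn_gt0 ?m_gt0 // -expnS.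
Qed.

End Gray.

(** * A machine that prints blocks of polynomial length *)

Section Printer.
Variables (A B : finType) (D : nat).

Notation symbol := (option (A + B + unit)).
Notation reads := {ffun 'I_D.+2 -> symbol}.
Notation dirs := {ffun 'I_D.+2 -> bool}.

(* A header, and the word printed at each tick of the loop that follows. *)
Definition block : Type := seq B * (reads -> seq B).

Variable blocks : seq block.

Definition block_at (b : nat) : block := nth ([::], fun=> [::]) blocks b.

Definition block_size : nat :=
  \max_(b < size blocks)
    maxn (size (block_at b).1) (\max_(r : reads) size ((block_at b).2 r)).

(* [inl] is the initial phase, which copies the input to the work tapes behind
   a left end mark.  In [inr (b, od, i)], block [b] is being printed and [i]
   letters of the current word are on the output tape; the heads are being
   rewound if [od] is None and otherwise move in the directions [od], true
   standing for left. *)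
Definition phase : finType :=
  (bool + 'I_(size blocks).+1 * option dirs * 'I_block_size.+1)%type.

Definition work (i : 'I_D.+2) : bool := 0 < i < D.+1.

(** A sweep ends on the left at the end mark and on the right at the first blank. *)
Definition stuck (ds : dirs) (r : reads) (i : 'I_D.+2) : bool :=
  if ds i then r i == Some (inr tt) else r i == None.

Definition carry (ds : dirs) (r : reads) (i : 'I_D.+2) : bool :=
  [forall j : 'I_D.+2, work j && (j < i) ==> stuck ds r j].

Definition new_dirs (ds : dirs) (r : reads) : dirs :=
  [ffun i => ds i (+) [&& work i, carry ds r i & stuck ds r i]].

Definition head_move (od : option dirs) (r : reads) (i : 'I_D.+2) : move :=
  if work i then
    if od is Some ds then
      if carry ds r i && ~~ stuck ds r i then
        if ds i then MoveLeft else MoveRight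
      else Stay
    else MoveLeft
  else Stay.

Definition rewound (r : reads) : bool :=
  [forall i, work i ==> (r i == Some (inr tt))].

Definition word (b : nat) (od : option dirs) (r : reads) : seq B :=
  if od is Some _ then (block_at b).2 r
  else if rewound r then (block_at b).1 else [::].

(** The index [ord_max] lies above all work tapes, so a carry into it means that the Gray code is
    exhausted and the next block begins. *)
Definition next_control (b : 'I_(size blocks).+1) (od : option dirs) (r : reads) :
    'I_(size blocks).+1 * option dirs :=
  if od is Some ds then
    if carry ds r ord_max then (inord b.+1, None) else (b, Some (new_dirs ds r))
  else if rewound r then (b, Some [ffun=> false]) else (b, None).

Definition letters (s : seq B) : seq symbol := [seq Some (inl (inr x)) | x <- s].

Definition printer_delta (q : phase) (r : reads) :
    phase * {ffun 'I_D.+2 -> symbol * move} :=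
  match q with
  | inl false =>
      (inl true, [ffun i => if work i then (Some (inr tt), MoveRight)
                            else (r i, Stay)])
  | inl true =>
      if r ord0 is Some _ then
        (inl true, [ffun i => if work i then (r ord0, MoveRight)
                              else (r i, if i == ord0 then MoveRight else Stay)])
      else (inr (ord0, None, ord0), [ffun i => (r i, Stay)])
  | inr (b, od, k) =>
      if k < size (word b od r) then
        (inr (b, od, inord k.+1),
         [ffun i => if i == ord_max then (nth None (letters (word b od r)) k, MoveRight)
                    else (r i, Stay)])
      else (inr (next_control b od r, ord0), [ffun i => (r i, head_move od r i)])
  end.

Definition printer : tm A B :=
  @TM A B D.+1 unit phase (inl false)
    (fun q => if q is inr (b, _, _) then b == size blocks :> nat else false)
    (fun=> false) printer_delta.

Lemma word_size b od r : size (word b od r) <= block_size.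
Proof.
have [ltb|leb] := ltnP b (size blocks); last first.
  by rewrite /word /block_at nth_default //=; case: od => //; case: ifP.
apply: leq_trans (@leq_bigmax _ (fun b : 'I_(size blocks) =>
  maxn (size (block_at b).1) (\max_r size ((block_at b).2 r))) (Ordinal ltb)).
rewrite leq_max /word; case: od => [ds|]; last by case: ifP; rewrite ?leqnn.
by rewrite (@leq_bigmax _ (fun r => size ((block_at b).2 r)) r) orbT.
Qed.

(** * Behaviour of the printer on a fixed input *)

Variable w : seq A.

Definition input_tape (j : nat) : symbol :=
  nth None [seq Some (inl (inl a)) | a <- w] j.

Definition work_tape (j : nat) : symbol :=
  if j is j'.+1 then input_tape j' else Some (inr tt).

Lemma input_tapeE j : (input_tape j == None) = (size w <= j).
Proof. by rewrite /input_tape; elim: w j => [|a s IH] [|j] //=; apply: IH. Qed.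

Lemma work_tape_left j : (work_tape j == Some (inr tt)) = (j == 0).
Proof.
case: j => [|j] //=; rewrite /input_tape.
by elim: w j => [|a s IH] [|j] //=; apply: IH.
Qed.

Lemma work_tape_right j : (work_tape j == None) = (size w < j).
Proof. by case: j => //= j; rewrite input_tapeE. Qed.

Definition snapshot : Type :=
  'I_(size blocks).+1 * option dirs * {ffun 'I_D.+2 -> nat}.

Implicit Types (x : snapshot) (b : 'I_(size blocks).+1) (out : seq B) (c : config printer).

(** While blocks are printed, the input head is past the input and the output head past the output,
    so both scan blanks. *)
Definition scan (p : {ffun 'I_D.+2 -> nat}) : reads :=
  [ffun i => if work i then work_tape (p i) else None].

Definition printed (x : snapshot) : seq B := word x.1.1 x.1.2 (scan x.2).

Definition next (x : snapshot) : snapshot :=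
  (next_control x.1.1 x.1.2 (scan x.2),
   [ffun i => apply_move (head_move x.1.2 (scan x.2) i) (x.2 i)]).

Record shows (x : snapshot) (k : nat) (out : seq B) (c : config printer) : Prop :=
  Shows {
    shows_state : cstate c = inr (x.1, inord k);
    shows_input : ctape c ord0 (chead c ord0) = None;
    shows_heads : forall i, work i -> chead c i = x.2 i;
    shows_work : forall i j, work i -> ctape c i j = work_tape j;
    shows_end : chead c ord_max = size out;
    shows_out : forall j, ctape c ord_max j = nth None (letters out) j
  }.

Lemma letters_default out j : size out <= j -> nth None (letters out) j = None.
Proof. by move=> h; rewrite nth_default // size_map. Qed.

Lemma workPn i : ~~ work i -> i = ord0 \/ i = ord_max.
Proof.
move=> nw; have [i0|] := boolP (val i == 0).
  by left; apply: val_inj; apply/eqP.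
move=> i0; right; apply: val_inj => /=; move: nw (ltn_ord i) i0.
by rewrite /work /=; lia.
Qed.

Lemma shows_scan x k out c :
  shows x k out c -> [ffun i => ctape c i (chead c i)] = scan x.2.
Proof.
move=> [_ inE hE wE eE oE]; apply/ffunP => i; rewrite !ffunE.
have [wi|/workPn[->|->]] := boolP (work i); first by rewrite wE // hE.
  by rewrite inE.
by rewrite oE eE letters_default.
Qed.

Lemma work_max : work ord_max = false.
Proof. by rewrite /work /= ltnn. Qed.

Lemma shows_print x k out c :
  x.1.1 < size blocks -> k < size (printed x) -> shows x k out c ->
  shows x k.+1 (out ++ take 1 (drop k (printed x))) (step c).
Proof.
move=> ltb ltk sh; have scE := shows_scan sh.
case: sh => sE inE hE wE eE oE.
have k_le : k <= block_size := leq_trans (ltnW ltk) (word_size _ _ _).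
rewrite /step sE; case: x => -[b od] p /= in ltb ltk sE hE scE *.
rewrite (ltn_eqF ltb) scE inordK // [k < _]ltk.
case def_a: (drop k _) => [|a s]; first by have := size_drop k (word b od (scan p));
  rewrite [drop _ _]def_a /=; move: ltk; rewrite /printed /=; lia.
have aE : nth None (letters (word b od (scan p))) k = Some (inl (inr a)).
  rewrite (nth_map a) //; congr (Some (inl (inr _))).
  by rewrite -[k in nth _ _ k]addn0 -nth_drop [drop _ _]def_a.
have scanE i : scan p i = ctape c i (chead c i) by rewrite -scE ffunE.
split=> /= [||i wi|i j wi||j] //.
- by rewrite !ffunE /= inE eqxx.
- rewrite ffunE; case: eqP => [ei|_] /=; first by rewrite ei work_max in wi.
  exact: hE.
- rewrite ffunE; case: (i =P ord_max) => [ei|_] /=; first by rewrite ei work_max in wi.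
  by case: eqP => [->|_] /=; rewrite ?scanE wE.
- by rewrite ffunE eqxx /= eE take0 size_cat /= addn1.
- rewrite ffunE eqxx /= eE oE take0 aE /letters map_cat nth_cat size_map.
  case: (ltngtP j (size out)) => [//|gt|->]; last by rewrite subnn.
  rewrite letters_default ?(ltnW gt) //.
  by case: (j - _) (subn_gt0 (size out) j) => [|[|n]] //=; rewrite gt.
Qed.

Lemma shows_word x out c : x.1.1 < size blocks -> shows x 0 out c ->
  shows x (size (printed x)) (out ++ printed x) (iter (size (printed x)) (@step _ _ printer) c).
Proof.
move=> ltb sh.
suff h k : k <= size (printed x) ->
    shows x k (out ++ take k (printed x)) (iter k (@step _ _ printer) c).
  by rewrite -[X in out ++ X]take_size; apply: h.
elim: k => [|k IH] ltk; first by rewrite take0 cats0.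
have := shows_print ltb ltk (IH (ltnW ltk)).
by rewrite -catA -takeD addn1.
Qed.

Lemma shows_next x out c : x.1.1 < size blocks ->
  shows x (size (printed x)) out c -> shows (next x) 0 out (step c).
Proof.
move=> ltb sh; have scE := shows_scan sh.
case: sh => sE inE hE wE eE oE.
rewrite /step sE; case: x => -[b od] p /= in ltb sE hE scE *.
rewrite (ltn_eqF ltb) scE inordK ?ltnS ?word_size // [_ < _]ltnn.
have scanE i : scan p i = ctape c i (chead c i) by rewrite -scE ffunE.
split=> /= [||i wi|i j wi||j].
- by congr (inr (_, _)); apply: val_inj; rewrite /= inordK.
- by rewrite !ffunE /= inE eqxx.
- by rewrite !ffunE /= hE.
- by rewrite ffunE scanE /=; case: eqP => [->|_]; rewrite wE.
- by rewrite ffunE /head_move work_max.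
- by rewrite ffunE scanE /=; case: eqP => [->|_]; rewrite oE.
Qed.

(** An upper bound on the time is enough, since a halted machine stays put. *)
Definition reaches (t : nat) x out (y : snapshot) : Prop :=
  forall c o, shows x 0 o c ->
  exists2 s, s <= t & shows y 0 (o ++ out) (iter s (@step _ _ printer) c).

Lemma reaches_refl x : reaches 0 x [::] x.
Proof. by move=> c o sh; exists 0; rewrite ?cats0. Qed.

Lemma reaches_trans t1 t2 x y z out1 out2 :
  reaches t1 x out1 y -> reaches t2 y out2 z -> reaches (t1 + t2) x (out1 ++ out2) z.
Proof.
move=> xy yz c o /xy[s1 le1 /yz[s2 le2]]; rewrite -catA -iterD => sh.
by exists (s2 + s1) => //; rewrite addnC leq_add.
Qed.

Lemma reaches_next x : x.1.1 < size blocks ->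
  reaches block_size.+1 x (printed x) (next x).
Proof.
move=> ltb c o /(shows_word ltb)/(shows_next ltb).
by rewrite -iterS; exists (size (printed x)).+1 => //; rewrite ltnS word_size.
Qed.

Definition left_end : {ffun 'I_D.+2 -> nat} := [ffun=> 0].

(** Entries off the work tapes are fixed at 0, so that the heads of a rewound snapshot are exactly
    [left_end]. *)
Definition bounded (k : nat) (p : {ffun 'I_D.+2 -> nat}) : Prop :=
  forall i, p i <= if work i then k else 0.

Lemma rewoundP (p : {ffun 'I_D.+2 -> nat}) :
  reflect (forall i, work i -> p i = 0) (rewound (scan p)).
Proof.
apply: (iffP forallP) => [h i wi|h i].
  by apply/eqP; rewrite -work_tape_left; have := h i; rewrite wi ffunE wi.
by apply/implyP => wi; rewrite ffunE wi work_tape_left h.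
Qed.

(** Each round moves all work heads left, those on cell 0 staying there; the round that sees all of
    them on the mark prints the header. *)
Lemma reaches_rewind b k p : b < size blocks -> bounded k p ->
  reaches (k.+1 * block_size.+1) (b, None, p) (block_at b).1
    (b, Some [ffun=> false], left_end).
Proof.
move=> ltb; elim: k p => [|k IH] p pk.
  rewrite mul1n; have rp : rewound (scan p).
    by apply/rewoundP => i wi; apply/eqP; have := pk i; rewrite wi leqn0.
  have := @reaches_next (b, None, p) ltb.
  rewrite /printed /next /= rp; congr reaches; congr (_, _).
  apply/ffunP => i; rewrite !ffunE /head_move.
  by have := pk i; case: ifP => _; case: (p i).
rewrite mulSn -[(block_at b).1]cat0s; have [rp|nrp] := boolP (rewound (scan p)).
  have p0 : bounded k p.
    move=> i; have := pk i; case: ifP => // wi _.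
    by rewrite (rewoundP _ rp).
  move=> c o /(IH _ p0)[s les sh]; exists s => //.
  exact: leq_trans les (leq_addl _ _).
have := @reaches_next (b, None, p) ltb.
rewrite /printed /next /= (negPf nrp) => /reaches_trans; apply; apply: IH => i.
by rewrite ffunE /head_move; have := pk i; case: ifP => //= _; lia.
Qed.

(** * The Gray code loop of the printer *)

Let m := (size w).+2.

(** Work tape [i] carries digit [i.-1]; its [m] positions are the end mark, the letters of [w] and
    one blank. *)
Definition gray_dirs (v : nat) : dirs := [ffun i => work i && gray_dir m v i.-1].

Definition gray_heads (v : nat) : {ffun 'I_D.+2 -> nat} :=
  [ffun i => if work i then gray_pos m v i.-1 else 0].

Lemma stuck_gray v i : work i ->
  stuck (gray_dirs v) (scan (gray_heads v)) i = gray_stuck m v i.-1.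
Proof.
move=> wi; rewrite /stuck /gray_stuck !ffunE wi /=.
have := @gray_pos_lt m isT v i.-1; rewrite /m /=.
case: gray_dir; first by rewrite work_tape_left.
by rewrite work_tape_right; lia.
Qed.

Lemma carry_gray v (i : 'I_D.+2) : 0 < i ->
  carry (gray_dirs v) (scan (gray_heads v)) i = (m ^ i.-1 %| v.+1).
Proof.
move=> i_gt0; apply/forallP/idP => [h|/(@dvdn_stuck m isT) h j]; last first.
  by apply/implyP => /andP[wj ji]; rewrite stuck_gray //; apply: h; case/andP: wj => /=; lia.
apply/(@dvdn_stuck m isT) => j ji.
have ltj : j.+1 < D.+2 by have := ltn_ord i; move: ji => /=; lia.
have wj : work (Ordinal ltj) by move: ltj ji (ltn_ord i); rewrite /work /=; lia.
by have := h (Ordinal ltj); rewrite stuck_gray // wj /= => /implyP; apply; lia.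
Qed.

Lemma gray_dirs0 : gray_dirs 0 = [ffun=> false].
Proof. by apply/ffunP => i; rewrite !ffunE /gray_dir div0n andbF. Qed.

Lemma gray_heads0 : gray_heads 0 = left_end.
Proof.
apply/ffunP => i; rewrite !ffunE /gray_pos /gray_dir /digit !div0n /= mod0n.
by rewrite if_same.
Qed.

Lemma next_gray b v : v.+1 < m ^ D ->
  next (b, Some (gray_dirs v), gray_heads v) =
  (b, Some (gray_dirs v.+1), gray_heads v.+1).
Proof.
move=> ltv; rewrite /next /next_control /= carry_gray //= gtnNdvd //=.
congr (_, Some _, _); apply/ffunP => i; rewrite !ffunE.
  case wi: (work i) => //=; rewrite stuck_gray // carry_gray ?gray_dirS //.
  by case/andP: wi.
rewrite /head_move; case wi: (work i) => //=; have i_gt0 : 0 < i by case/andP: wi.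
rewrite stuck_gray // carry_gray // gray_posS // ffunE wi /=.
by case: ifP => // _; case: gray_dir.
Qed.

Definition ticks (g : reads -> seq B) (k : nat) : seq B :=
  flatten [seq g (scan (gray_heads v)) | v <- iota 0 k].

Lemma ticksS g k : ticks g k.+1 = ticks g k ++ g (scan (gray_heads k)).
Proof. by rewrite /ticks -addn1 iotaD map_cat flatten_cat /= cats0. Qed.

Lemma reaches_ticks b k : b < size blocks -> k < m ^ D ->
  reaches (k * block_size.+1) (b, Some [ffun=> false], left_end)
    (ticks (block_at b).2 k) (b, Some (gray_dirs k), gray_heads k).
Proof.
move=> ltb; elim: k => [|k IH] ltk.
  by rewrite gray_dirs0 gray_heads0; apply: reaches_refl.
rewrite mulSnr ticksS; apply: reaches_trans (IH (ltnW ltk)) _.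
rewrite -next_gray //.
exact: (@reaches_next (b, Some (gray_dirs k), gray_heads k)).
Qed.

Definition block_text (blk : block) : seq B := blk.1 ++ ticks blk.2 (m ^ D).

Definition block_time : nat := (m.+1 + m ^ D) * block_size.+1.

Lemma reaches_block b p : b < size blocks -> bounded m p ->
  exists2 p', bounded m p' &
    reaches block_time (b, None, p) (block_text (block_at b)) (inord b.+1, None, p').
Proof.
move=> ltb pm; have mD : (m ^ D).-1.+1 = m ^ D by rewrite prednK // expn_gt0.
pose x : snapshot := (b, Some (gray_dirs (m ^ D).-1), gray_heads (m ^ D).-1).
exists (next x).2.
  move=> i; rewrite !ffunE /head_move; case wi: (work i) => //=.
  have := @gray_pos_lt m isT (m ^ D).-1 i.-1.
  by case: ifP => _ //=; [case: ifP => _ /=|]; lia.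
rewrite /block_time mulnDl; apply: reaches_trans (reaches_rewind ltb pm) _.
(* The last of the [m ^ D] ticks is split off, because its carry leaves the block. *)
rewrite -mD mulSnr ticksS; apply: reaches_trans (reaches_ticks ltb _) _.
  by rewrite mD.
have -> : (inord b.+1, None, (next x).2) = next x.
  by rewrite /next /next_control /= carry_gray //= mD dvdnn.
exact: (@reaches_next x).
Qed.

Lemma reaches_blocks k p : k <= size blocks -> bounded m p ->
  exists2 p', bounded m p' &
    reaches (k * block_time) (ord0, None, p)
      (flatten (map block_text (take k blocks))) (inord k, None, p').
Proof.
move=> + pm; elim: k => [|k IH] ltk.
  exists p => //; rewrite take0; have -> : inord 0 = ord0 :> 'I_(size blocks).+1.
    by apply: val_inj; rewrite /= inordK.
  exact: reaches_refl.
have [q qm rq] := IH (ltnW ltk).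
have kE : (inord k : 'I_(size blocks).+1) = k :> nat by rewrite inordK // ltnS ltnW.
have ltk' : (inord k : 'I_(size blocks).+1) < size blocks by rewrite kE.
have [p' pm' rp] := reaches_block ltk' qm; exists p' => //.
rewrite (take_nth ([::], fun=> [::])) // map_rcons flatten_rcons mulSnr.
by move: rp; rewrite kE; apply: reaches_trans.
Qed.

(** * Copying the input to the work tapes, and the whole run of the printer *)

Record copied (k : nat) (c : config printer) : Prop :=
  Copied {
    copied_state : cstate c = inl true;
    copied_input_head : chead c ord0 = k;
    copied_input : forall j, ctape c ord0 j = input_tape j;
    copied_heads : forall i, work i -> chead c i = k.+1;
    copied_work : forall i j, work i ->
      ctape c i j = if j <= k then work_tape j else None;
    copied_end : chead c ord_max = 0;
    copied_out : forall j, ctape c ord_max j = None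
  }.

Lemma init_copied : copied 0 (run printer w 1).
Proof.
rewrite /run /= /step /=; split=> //= [|j|i wi|i j wi||j].
- by rewrite ffunE.
- by rewrite !ffunE /=; case: eqP => [->|].
- by rewrite ffunE wi.
- have i0 : (i == ord0) = false by apply/eqP => e; rewrite e in wi.
  by rewrite ffunE wi i0; case: j.
- by rewrite ffunE work_max.
- by rewrite !ffunE work_max /=; case: eqP.
Qed.

Lemma step_copied k c : k < size w -> copied k c -> copied k.+1 (step c).
Proof.
move=> ltk [sE ihE iE hE wE eE oE].
have [y yE] : exists y, input_tape k = Some y.
  by case E: (input_tape k) => [y|]; [exists y|move/eqP: E; rewrite input_tapeE leqNgt ltk].
rewrite /step sE /= ffunE ihE iE yE /=.
split=> //= [|j|i wi|i j wi||j].
- by rewrite !ffunE ihE.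
- by rewrite !ffunE ihE /= iE; case: eqP => [->|].
- by rewrite ffunE wi /= hE.
- rewrite ffunE wi hE //= wE //; case: (ltngtP j k.+1) => [lt|gt|->] //=.
  + by rewrite -ltnS lt.
  + by rewrite leqNgt (ltnW gt).
- by rewrite ffunE work_max.
- by rewrite !ffunE work_max /= eE oE; case: eqP.
Qed.

Definition right_end : {ffun 'I_D.+2 -> nat} := [ffun i => if work i then m.-1 else 0].

Lemma copied_shows c : copied (size w) c ->
  shows (ord0, None, right_end) 0 [::] (step c).
Proof.
move=> [sE ihE iE hE wE eE oE].
have iN : input_tape (size w) = None by apply/eqP; rewrite input_tapeE.
rewrite /step sE /= ffunE ihE iE iN /=.
split=> /= [||i wi|i j wi||j].
- by congr (inr (_, _)); apply: val_inj; rewrite /= inordK.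
- by rewrite !ffunE /= ihE iE iN if_same.
- by rewrite !ffunE wi /= hE.
- rewrite !ffunE hE // !wE // ltnn.
  have wN l : size w < l -> work_tape l = None.
    by rewrite -work_tape_right => /eqP.
  case: eqP => [->|_]; first by rewrite wN.
  by case: leqP => // gt; rewrite wN.
- by rewrite ffunE /= eE.
- by rewrite !ffunE !oE if_same nth_nil.
Qed.

Lemma printer_run : exists2 t, t <= m + size blocks * block_time &
  let e := run printer w t in
  halting (cstate e) /\
  forall j, ctape e ord_max j =
    nth None (letters (flatten (map block_text blocks))) j.
Proof.
have copy k : k <= size w -> copied k (run printer w k.+1).
  elim: k => [|k IH] ltk; first exact: init_copied.
  by rewrite /run iterS; apply: step_copied => //; apply/IH/ltnW.
have rb : bounded m right_end by move=> i; rewrite ffunE; case: ifP => // _; rewrite leq_pred.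
have [p _] := reaches_blocks (leqnn _) rb; rewrite take_size.
move=> /(_ _ _ (copied_shows (copy _ (leqnn _))))[s les sh].
exists (s + m); first by rewrite addnC leq_add2l.
rewrite /run iterD; case: sh => sE _ _ _ _ oE; split=> //.
by rewrite sE /= inordK.
Qed.

Lemma run_halted (M : tm A B) (c : config M) k :
  halting (cstate c) -> iter k (@step A B M) c = c.
Proof. by move=> hc; elim: k => //= k ->; rewrite /step hc. Qed.

End Printer.

(** The left side is the time bound of a printer with [S] blocks on inputs of length [n], where [K]
    bounds the time of one tick. *)
Lemma polynomial_bound (D S K : nat) : exists c d, forall n,
  n.+2 + S * ((n.+3 + n.+2 ^ D) * K) <= c * n ^ d + c.
Proof.
(* The factor [3 ^ D.+1] comes from [n.+2 <= 3 * n] for positive [n]; the additive constant covers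
   [n = 0]. *)
exists (3 ^ D.+1 * (1 + 3 * S * K)), D.+1 => n.
have h1 : n.+2 <= n.+2 ^ D.+1 by rewrite -{1}[n.+2]expn1 leq_pexp2l.
have h2 : n.+2 ^ D <= n.+2 ^ D.+1 by rewrite leq_pexp2l.
have h3 : n.+2 ^ D.+1 <= 3 ^ D.+1 * n ^ D.+1 + 3 ^ D.+1.
  case: n {h1 h2} => [|n]; first by rewrite (leq_trans _ (leq_addl _ _)) // leq_exp2r.
  by rewrite -expnMn (leq_trans _ (leq_addr _ _)) // leq_exp2r //; lia.
have h4 : (n.+3 + n.+2 ^ D) * K <= 3 * n.+2 ^ D.+1 * K by rewrite leq_mul2r; apply/orP; right; lia.
have h5 : S * ((n.+3 + n.+2 ^ D) * K) <= S * (3 * n.+2 ^ D.+1 * K) by rewrite leq_mul2l h4 orbT.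
have h6 := leq_mul h3 (leqnn (1 + 3 * S * K)).
move: h1 h5 h6; move: (n.+2 ^ _) (3 ^ _) (n ^ _) (S * (_ * K)) => a b e f; nia.
Qed.

Lemma polytime_blocks (A B : finType) (D : nat) (blocks : seq (block A B D)) :
  polytime (fun w => flatten (map (block_text w) blocks)).
Proof.
have [c [d bound]] := polynomial_bound D (size blocks) (block_size blocks).+1.
exists (printer blocks), c, d => w /=.
have [t let_ [ht ot]] := printer_run blocks w.
have le : t <= c * size w ^ d + c := leq_trans let_ (bound (size w)).
rewrite /run -(subnK le) iterD run_halted //; exact: conj.
Qed.


(** * Printing the instance *)

Definition box_word : seq token := TUnder :: encode_formula (Letter 0).

Lemma encode_iter_box n A :
  encode_formula (iter n box A) = flatten (nseq n box_word) ++ encode_formula A.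
Proof. by elim: n => //= n ->. Qed.

Definition chain_link (X : formula) : seq token :=
  TAnd :: encode_formula X ++ box_word.

Lemma encode_chain (T : finType) (s : seq T) :
  encode_formula (chain s) =
  flatten [seq chain_link (cell x) | x <- s] ++ encode_formula top.
Proof. by elim: s => //= x s ->; rewrite -!catA. Qed.

Lemma encode_chain_mkseq (T : finType) (u : nat -> T) P :
  encode_formula (chain (mkseq u P.+1)) =
  chain_link (cell (u 0)) ++ flatten [seq chain_link (cell (u v.+1)) | v <- iota 0 P]
    ++ encode_formula top.
Proof.
rewrite encode_chain /mkseq -map_comp.
have -> : iota 0 P.+1 = 0 :: map S (iota 0 P) by rewrite -(iotaDl 1).
by rewrite map_cons -map_comp catA.
Qed.

Section Reduction.
Variables (A : finType) (M : tm A void) (D : nat).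
Hypothesis D_gt0 : 0 < D.

Notation reads := {ffun 'I_D.+2 -> option (A + token + unit)}.
Notation T := (hcell M).

Definition period (w : seq A) : nat := (size w).+2 ^ D.

Definition reduction (w : seq A) : instance :=
  history_instance (@next_cell A M) (@accepting_cell A M) (period w)
    (mkseq (history M w (period w)) (period w).+1).

(* The raw cell number [v], read off the heads at tick [v] of the loop: the
   input is read during the first sweep of the first work tape. *)
Definition tick_cell (r : reads) : option (option A) :=
  if [exists i : 'I_D.+2, (1 < i < D.+1) && (r i != Some (inr tt))] then Some None
  else match r (inord 1) with
       | Some (inr _) => None
       | Some (inl (inl a)) => Some (Some a)
       | _ => Some None
       end.

(** The loops of the first two blocks print the boxes before [X] and before [box Y]; that of the
    third prints nothing. *)
Definition implication_blocks (X W Y : formula) : seq (block A token D) :=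
  [:: ([:: TAssume; TAnd], fun=> box_word);
      (encode_formula X ++ encode_formula W, fun=> box_word);
      (box_word ++ encode_formula Y, fun=> [::])].

Definition rule_blocks (q : T * T * T * T) : seq (block A token D) :=
  let: (x, a, b, c) := q in
  implication_blocks (cell x) (window q) (cell (next_cell x a b c)).

Definition raw_formula (y : option (option A)) : formula := cell (inl y : T).

Definition chain_blocks (pre : seq token) (f : option (option A) -> seq token)
    (post : seq token) : seq (block A token D) :=
  [:: (pre, fun r => f (tick_cell r)); (post, fun=> [::])].

Definition goal_blocks : seq (block A token D) :=
  chain_blocks
    (flatten [seq encode_assumption s | s <- closing_rules (@accepting_cell A M)] ++
     TGoal :: chain_link (raw_formula (Some None)))
    (fun y => chain_link (raw_formula y)) (encode_formula top ++ encode_formula acc).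

Definition reduction_blocks : seq (block A token D) :=
  flatten [seq rule_blocks q | q <- enum {: T * T * T * T}] ++ goal_blocks.

Lemma ticks_cst w (u : seq token) k :
  ticks w (fun _ : reads => u) k = flatten (nseq k u).
Proof. by rewrite /ticks; elim: k 0 => //= k IH i; rewrite IH. Qed.

(** In the first [m] ticks only the first work head leaves the end mark; it sweeps the mark, the
    input and a blank, matching the sentinel, the input cells and a blank cell. *)
Lemma tick_cellE w v : v < period w ->
  tick_cell (scan token w (gray_heads D w v)) = raw_cell w v.
Proof.
rewrite /period => ltv; set m := (size w).+2 in ltv *.
have w1 : @work D (inord 1) by rewrite /work inordK.
have [ltm|lem] := ltnP v m.
  rewrite /tick_cell ifF; last first.
    apply/existsP => -[i /andP[/andP[i1 iD]]].
    have wi : work i by rewrite /work iD andbT ltnW.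
    rewrite /scan /gray_heads !ffunE wi work_tape_left gray_pos_small //; last first.
      by apply: leq_trans ltm _; rewrite -{1}[m]expn1 leq_pexp2l //; lia.
    rewrite divn_small //; apply: leq_trans ltm _.
    by rewrite -{1}[m]expn1 leq_pexp2l //; lia.
  rewrite /scan /gray_heads !ffunE w1 inordK // gray_pos_small ?expn1 // divn1.
  case: v {ltv ltm} => [|j] //=; rewrite /input_tape.
  by elim: w j {m w1} => [|a s IH] [|j] //=.
(* The leading digit [i1] of [v] is nonzero and in its first sweep, so the head of tape [i1.+1],
   which is not the first work tape, is off the mark. *)
have [i1 /andP[lei lti]] : exists i, m ^ i <= v < m ^ i.+1.
  by exists (trunc_log m v); apply: trunc_log_bounds => //; apply: leq_trans lem.
have i1_gt0 : 0 < i1.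
  by case: i1 {lei} lti => //; rewrite expn1 ltnNge lem.
have i1_lt : i1 < D by rewrite -(@ltn_exp2l m) //; apply: leq_ltn_trans ltv.
have ltD : i1.+1 < D.+2 by lia.
rewrite /tick_cell ifT; last first.
  apply/existsP; exists (Ordinal ltD); rewrite /= !ltnS i1_gt0 i1_lt /=.
  rewrite /scan /gray_heads !ffunE /work /= ltnS i1_lt work_tape_left gray_pos_small //.
  by rewrite -lt0n divn_gt0 ?expn_gt0.
case: v lem {ltv lei lti} => [|j] //= lem.
by rewrite nth_default // size_map; lia.
Qed.

Lemma ticks_nil w k : ticks w (fun _ : reads => [::] : seq token) k = [::].
Proof. by rewrite ticks_cst; elim: k. Qed.

Lemma block_text_implication w X W Y :
  flatten [seq block_text w b | b <- implication_blocks X W Y] =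
  encode_assumption (And (iter (period w) box X) W, iter (period w) box (box Y)).
Proof.
rewrite /encode_assumption /= /block_text /= !ticks_nil !ticks_cst -/(period w).
by rewrite !encode_iter_box /= !cats0 -!catA.
Qed.

Lemma block_text_rule w q :
  flatten [seq block_text w b | b <- rule_blocks q] =
  encode_assumption (rule (@next_cell A M) (period w) q).
Proof. by case: q => [[[x a] b] c]; apply: block_text_implication. Qed.

Lemma ticks_raw w (f : option (option A) -> seq token) k : k <= period w ->
  ticks w (fun r : reads => f (tick_cell r)) k =
  flatten [seq f (raw_cell w v) | v <- iota 0 k].
Proof.
elim: k => [|k IH] // ltk; rewrite ticksS IH ?(ltnW ltk) // tick_cellE //.
by rewrite -[in RHS]addn1 iotaD map_cat flatten_cat /= cats0.
Qed.

Lemma block_text_chain w pre f post :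
  flatten [seq block_text w b | b <- chain_blocks pre f post] =
  pre ++ flatten [seq f (raw_cell w v) | v <- iota 0 (period w)] ++ post.
Proof. by rewrite /= /block_text /= ticks_nil ticks_raw //= !cats0 -catA. Qed.

Lemma encode_chain_history w P (u := history M w P) :
  encode_formula (chain (mkseq u P.+1)) =
  chain_link (raw_formula (Some None)) ++
  flatten [seq chain_link (raw_formula (raw_cell w v)) | v <- iota 0 P] ++
  encode_formula top.
Proof.
rewrite encode_chain_mkseq; congr (_ ++ (flatten _ ++ _)).
apply/eq_in_map => v; rewrite mem_iota => /andP[_ ltv].
by rewrite /u history_raw.
Qed.

Lemma encode_reduction w :
  encode_instance (reduction w) = flatten [seq block_text w b | b <- reduction_blocks].
Proof.
pose u := history M w (period w).
rewrite /encode_instance.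
rewrite -[encode_antecedent _]/(encode_formula (chain (mkseq u (period w).+1))).
rewrite -[assumptions _]/(rules (@next_cell A M) (@accepting_cell A M) (period w)).
rewrite -[goal_suc _]/acc encode_chain_history.
rewrite /rules /reduction_blocks !map_cat !flatten_cat block_text_chain.
have -> : flatten (map (block_text w) (flatten (map rule_blocks (enum {: T * T * T * T})))) =
    flatten (map encode_assumption (map (rule (@next_cell A M) (period w))
      (enum {: T * T * T * T}))).
  elim: (enum _) => // q s IH.
  by rewrite !map_cons /= map_cat flatten_cat IH block_text_rule.
by rewrite -!catA.
Qed.

End Reduction.

(** * Correctness of the reduction *)

Lemma polynomial_lt_exp c d n : c * n ^ d + c < n.+2 ^ (c + d).+1.
Proof.
have hc : c < n.+2 ^ c by rewrite ltn_expl.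
have hd : n ^ d <= n.+2 ^ d.
  by case: d => [|d]; rewrite ?expn0 // leq_exp2r //; lia.
have h1 : 0 < n.+2 ^ d by rewrite expn_gt0.
(* The power [n.+2 ^ c] absorbs the coefficient [c], and the extra factor [n.+2], at least 2,
   absorbs the summand [c]. *)
rewrite expnS expnD; move: (n.+2 ^ c) (n.+2 ^ d) (n ^ d) hc hd h1 => x y z hc hd h1.
 by apply: (@leq_trans (2 * (c.+1 * y))); [nia|do 2?[apply: leq_mul => //]].
Qed.

Lemma run_halted_le (A B : finType) (M : tm A B) w s t : s <= t ->
  halting (cstate (run M w s)) -> run M w t = run M w s.
Proof. by move=> st hs; rewrite /run -(subnK st) iterD run_halted. Qed.

Theorem theorem9 : PSPACE_hard encode_instance consequence.
Proof.
move=> A L [M [c [d ML]]]; pose D := (c + d).+1.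
exists (reduction M D); split.
  have [M' [c' [d' pt]]] := polytime_blocks (reduction_blocks M D).
  exists M', c', d' => w; have [hw ow] := pt w; split=> // j.
  by rewrite ow encode_reduction.
move=> w; have [heads [t [ht accL]]] := ML w.
have P_gt1 : 1 < period D w.
  by rewrite /period /D expnS; apply: (@leq_mul 2 1) => //; rewrite expn_gt0.
have head_lt s i : (chead (run M w s) i).+1 < period D w.
  exact: leq_ltn_trans (heads s i) (polynomial_lt_exp _ _ _).
have uF N := history_next (ltnW P_gt1) head_lt N.
split=> [Lw|].
  (* The witness is the sentinel of the row of configuration [t]. *)
  apply: (history_complete P_gt1 uF (N := (t.+1 * period D w).+1)).
  exact/history_accepts/accL/Lw/ht/(ltnW P_gt1).
move=> der; apply/accL/negPn/negP => nacc; apply: (history_sound P_gt1 uF) der.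
(* All halted configurations of one run coincide, so none of them accepts. *)
apply: history_rejects => s hs; suff -> : run M w s = run M w t by [].
by case/orP: (leq_total s t) => le; [rewrite (run_halted_le le hs)|rewrite (run_halted_le le ht)].
Qed.
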